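(* Let $f,g:[a,b]\to\mathbb{R}$ be two integrable mappings. Then $$\left|\mathcal{T}_a^v(f,g)-\mathcal{T}_u^b(f,g)\right|\le \left(\mathcal{T}_a^v(f,f)\right)^{1/2}\left(\mathcal{T}_a^v(g,g)\right)^{1/2}+\left(\mathcal{T}_u^b(f,f)\right)^{1/2}\left(\mathcal{T}_u^b(g,g)\right)^{1/2}$$ $$\le \frac12\left[\mathcal{T}_a^v(f,f)+\mathcal{T}_a^v(g,g)+\mathcal{T}_u^b(f,f)+\mathcal{T}_u^b(g,g)\right]$$ for all $a\le u<v\le b$. The double inequality is sharp.
   Context: For real numbers $\alpha<\beta$ and integrable $f,g$ on $[\alpha,\beta]$, the Čebyšev functional is $$\mathcal{T}_\alpha^\beta(f,g)=\frac{1}{\beta-\alpha}\int_\alpha^\beta f(t)g(t)\,dt-\frac{1}{\beta-\alpha}\int_\alpha^\beta f(t)\,dt\cdot\frac{1}{\beta-\alpha}\int_\alpha^\beta g(t)\,dt.$$ ''Sharp'' means that neither right-hand side can, in general, be multiplied by a constant smaller than $1$. *)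

(* Defs.v *)
From HB Require Import structures.
From mathcomp Require Import all_boot all_order all_algebra.
From mathcomp Require Import all_classical all_reals all_analysis.

Set Implicit Arguments.
Unset Strict Implicit.
Unset Printing Implicit Defensive.

Import Order.TTheory GRing.Theory Num.Theory.
Import numFieldNormedType.Exports.

Local Open Scope classical_set_scope.
Local Open Scope ring_scope.
Local Open Scope ereal_scope.

(* Measurability is with respect to the full (completed) Lebesgue
   sigma-algebra rather than the Borel one, so that Riemann integrable
   functions are included.  Functions on [alpha, beta] are represented by
   total functions on R, of which only the values on [alpha, beta] matter. *)
Definition integrable_on (R : realType) (alpha beta : R) (f : R -> R) : Prop :=
  (@completed_lebesgue_measure R).-integrable `[alpha, beta]
    (fun t => (f t)%:E).

Definition mean (R : realType) (alpha beta : R) (f : R -> R) : \bar R :=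
  ((beta - alpha)^-1)%:E *
  \int[@completed_lebesgue_measure R]_(t in `[alpha, beta]) (f t)%:E.

(* The functional takes values in \bar R because f * g need not be integrable
   when f and g are.  For integrable f, cebysev alpha beta f f = +oo exactly
   when f is not square integrable; if f and g are square integrable, every
   value of the functional on them is finite and this is the usual real-valued
   functional. *)
Definition cebysev (R : realType) (alpha beta : R) (f g : R -> R) : \bar R :=
  mean alpha beta (fun t => f t * g t)%R
  - mean alpha beta f * mean alpha beta g.

(* In \bar R, 0 * +oo = 0. *)
Definition product_bound (R : realType) (a b u v : R) (f g : R -> R) : \bar R :=
  cebysev a v f f `^ 2^-1 * cebysev a v g g `^ 2^-1
  + cebysev u b f f `^ 2^-1 * cebysev u b g g `^ 2^-1.

Definition sum_bound (R : realType) (a b u v : R) (f g : R -> R) : \bar R :=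
  (2^-1)%:E * (cebysev a v f f + cebysev a v g g
               + cebysev u b f f + cebysev u b g g).

(* Main.v *)
Require Import Defs.
From HB Require Import structures.
From mathcomp Require Import all_boot all_order all_algebra.
From mathcomp Require Import all_classical all_reals all_analysis.
From mathcomp Require Import measurable_realfun ring lra.

Import Order.TTheory GRing.Theory Num.Theory.
Import numFieldNormedType.Exports.
Local Open Scope classical_set_scope.
Local Open Scope ring_scope.
Local Open Scope ereal_scope.

(** The functional T(f, g) is the covariance of f and g for the uniform
    probability on the interval, so that T(f, f) is a variance and the heart of
    the matter is the Cauchy-Schwarz inequality
    |T(f, g)| <= T(f, f)^(1/2) T(g, g)^(1/2) on one interval
    ([ecov_cauchy_schwarz]).  Applied on [a, v] and on [u, b] and combined with
    the triangle inequality, it gives the first bound; the second one is the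
    inequality between arithmetic and geometric means on each interval
    ([poweR_am_gm]).

    As f and g are only integrable, variances may be infinite and the
    Cauchy-Schwarz inequality has to hold in the extended reals.
    - If f and g are square integrable, so is every x f + g; its variance, a
      quadratic polynomial in x, is nonnegative, hence has a nonpositive
      discriminant.
    - If one variance is infinite and the other one positive, the right-hand
      side is infinite.
    - If one variance is zero, the right-hand side is zero even when the other
      factor is infinite.  The function with zero variance is then almost
      everywhere equal to its mean, and its covariance with any integrable
      function, square integrable or not, is zero ([ecov_degenerate]).

    For sharpness, take v = b, the midpoint u of [a, b], and for both f and g
    the step function that is 1 before u and 0 from u on.  It is constant on
    [u, b], and its variance on [a, b] is 1/2 - (1/2)^2 = 1/4.  All three
    members of the double inequality are then equal to 1/4, so no constant
    smaller than 1 can be inserted ([step_attains_bounds]). *)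

(** * Elementary inequalities *)

Lemma discriminant_le (R : rcfType) (F G H : R) :
  (forall x : R, 0 <= x ^+ 2 * F + 2 * x * H + G)%R -> (H ^+ 2 <= F * G)%R.
Proof.
move=> q; pose p := Poly [:: G; (2 * H)%R; F].
have p_ge0 x : (0 <= p.[x])%R.
  have := q x; rewrite horner_Poly/=; congr (is_true (_ <= _)%R); ring.
have := @deg_le2_poly_ge0 _ p (size_Poly _) p_ge0; rewrite !coefE /=; lra.
Qed.

Lemma poweR_am_gm (R : realType) (x y : \bar R) : 0 <= x -> 0 <= y ->
  x `^ 2^-1 * y `^ 2^-1 <= (2^-1)%:E * (x + y).
Proof.
have half_gt0 : (0 : \bar R) < (2^-1)%:E by rewrite lte_fin invr_gt0.
case: x y => [x| |] [y| |] //; last 3 first.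
- by move=> *; rewrite [_ + _]addey// gt0_muley// leey.
- by move=> *; rewrite [_ + _]addye// gt0_muley// leey.
- by move=> *; rewrite [_ + _]addye// gt0_muley// leey.
rewrite !lee_fin => x0 y0; rewrite !powR12_sqrt//.
have := sqr_ge0 (Num.sqrt x - Num.sqrt y).
have := sqr_sqrtr x0; have := sqr_sqrtr y0; rewrite sqrrB mulr2n.
lra.
Qed.

(** * Covariance over a set of finite positive measure *)

Section covariance_on_a_set.
Context d (T : measurableType d) (R : realType).
Context (mu : {measure set T -> \bar R}) (D : set T) (m : R).
Hypotheses (mD : measurable D) (m_gt0 : (0 < m)%R) (muD : mu D = m%:E).
Implicit Types f g h : T -> R.

Local Notation L1 f := (mu.-integrable D (EFin \o f)).

Definition emean f : \bar R := m^-1%:E * \int[mu]_(t in D) (f t)%:E.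

Definition rmean f : R := (m^-1 * fine (\int[mu]_(t in D) (f t)%:E))%R.

(** Not written as the mean of the product of the centered functions: for f and
    g merely integrable, this form makes sense as soon as the mean of the
    product does, and it is the shape of the functional under study. *)
Definition ecov f g : \bar R :=
  emean (fun t => f t * g t)%R - emean f * emean g.

Definition rcov f g : R :=
  (rmean (fun t => f t * g t) - rmean f * rmean g)%R.

Lemma emeanE f : L1 f -> emean f = (rmean f)%:E.
Proof.
by move=> f1; rewrite /emean /rmean EFinM fineK// integrable_fin_num.
Qed.

Lemma ecovE f g : L1 f -> L1 g -> L1 (fun t => f t * g t)%R ->
  ecov f g = (rcov f g)%:E.
Proof. by move=> f1 g1 fg1; rewrite /ecov !emeanE. Qed.

Lemma ecovC f g : ecov f g = ecov g f.
Proof.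
rewrite /ecov muleC; congr (_ - _); congr emean.
by apply/funext => t; rewrite mulrC.
Qed.

Lemma L1_measurable f : L1 f -> measurable_fun D f.
Proof. by move=> /measurable_int/measurable_EFinP. Qed.

Lemma L1D f g : L1 f -> L1 g -> L1 (fun t => f t + g t)%R.
Proof. by move=> f1 g1; exact: (integrableD mD f1 g1). Qed.

Lemma L1Z k f : L1 f -> L1 (fun t => k * f t)%R.
Proof. by move=> f1; exact: (integrableZl mD k f1). Qed.

Lemma L1_cst k : L1 (fun=> k).
Proof.
apply: measurable_bounded_integrable => //; first by rewrite muD ltry.
by exists `|k|%R; split => // M kM t _ /=; exact: ltW.
Qed.

(** From 2 |x y| <= x ^ 2 + y ^ 2. *)
Lemma L1M f g : L1 f -> L1 g ->
  L1 (fun t => f t * f t)%R -> L1 (fun t => g t * g t)%R ->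
  L1 (fun t => f t * g t)%R.
Proof.
move=> f1 g1 f2 g2; apply: (le_integrable mD _ _ (L1D _ _ f2 g2)).
  apply/measurable_EFinP/measurable_funM; exact: L1_measurable.
move=> t _ /=; rewrite lee_fin [leRHS]ger0_norm ?ler_norml; nra.
Qed.

Lemma rmeanD f g : L1 f -> L1 g ->
  rmean (fun t => f t + g t)%R = (rmean f + rmean g)%R.
Proof.
by move=> f1 g1; rewrite /rmean -mulrDr; congr (_ * _)%R; exact: RintegralD.
Qed.

Lemma rmeanZ k f : L1 f -> rmean (fun t => k * f t)%R = (k * rmean f)%R.
Proof.
by move=> f1; rewrite /rmean mulrCA; congr (_ * _)%R; exact: RintegralZl.
Qed.

Lemma rmean_cst k : rmean (fun=> k) = k.
Proof.
have := Rintegral_cst mu mD k; rewrite /Rintegral /rmean => ->.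
by rewrite muD /= mulrCA mulVf ?mulr1// gt_eqF.
Qed.

Lemma centered_sqrE f k : (fun t => (f t - k) ^+ 2)%R =
  (fun t => f t * f t + ((- 2 * k) * f t + k ^+ 2))%R :> (T -> R).
Proof. by apply/funext => t; ring. Qed.

(** In this form the variance is visibly nonnegative, and its vanishing forces
    f to be almost everywhere equal to its mean. *)
Lemma rcov_centered f : L1 f -> L1 (fun t => f t * f t)%R ->
  rcov f f = rmean (fun t => (f t - rmean f) ^+ 2)%R.
Proof.
move=> f1 f2; set k := rmean f.
rewrite centered_sqrE.
rewrite rmeanD//; last by apply: L1D; [exact: L1Z|exact: L1_cst].
rewrite rmeanD; [|exact: L1Z|exact: L1_cst].
by rewrite rmean_cst rmeanZ// /rcov -/k; ring.
Qed.

Lemma rcov_ge0 f : L1 f -> L1 (fun t => f t * f t)%R -> (0 <= rcov f f)%R.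
Proof.
move=> f1 f2; rewrite rcov_centered// mulr_ge0 ?invr_ge0 ?(ltW m_gt0)//.
by apply: Rintegral_ge0 => t _; exact: sqr_ge0.
Qed.

(** The variance of x f + g is the polynomial rcov f f x^2 + 2 rcov f g x +
    rcov g g in x, and it is nonnegative for all x. *)
Lemma rcov_cauchy_schwarz f g : L1 f -> L1 g ->
  L1 (fun t => f t * f t)%R -> L1 (fun t => g t * g t)%R ->
  (rcov f g ^+ 2 <= rcov f f * rcov g g)%R.
Proof.
move=> f1 g1 f2 g2; apply: discriminant_le => x.
have fg1 := L1M _ _ f1 g1 f2 g2.
have sq : (fun t => (x * f t + g t) * (x * f t + g t))%R =
    (fun t => (x ^+ 2 * (f t * f t) + (2 * x * (f t * g t) + g t * g t)))%R
    :> (T -> R).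
  by apply/funext => t; ring.
have h1 : L1 (fun t => x * f t + g t)%R by apply: L1D => //; exact: L1Z.
have h2' : L1 (fun t => 2 * x * (f t * g t) + g t * g t)%R.
  by apply: L1D => //; exact: L1Z.
have h2 : L1 (fun t => (x * f t + g t) * (x * f t + g t))%R.
  by rewrite sq; apply: L1D => //; exact: L1Z.
have := rcov_ge0 _ h1 h2; congr (is_true (_ <= _)%R).
rewrite /rcov sq rmeanD//; last exact: L1Z.
rewrite (rmeanD (fun t => 2 * x * (f t * g t))%R)//; last exact: L1Z.
rewrite (rmeanD (fun t => x * f t)%R)//; last exact: L1Z.
by rewrite !rmeanZ//; ring.
Qed.

(** The mean of an integrable f is finite, so it cannot compensate for the
    infinite mean of f ^ 2. *)
Lemma ecov_pinfty f : L1 f -> ~ L1 (fun t => f t * f t)%R -> ecov f f = +oo.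
Proof.
move=> f1 nf2; rewrite /ecov (emeanE f)// -EFinM.
suff -> : emean (fun t => f t * f t)%R = +oo by [].
have int_ge0 : 0 <= \int[mu]_(t in D) (f t * f t)%:E.
  by apply: integral_ge0 => t _; rewrite lee_fin -expr2 sqr_ge0.
suff int_y : \int[mu]_(t in D) (f t * f t)%:E = +oo.
  by rewrite /emean int_y gt0_muley// lte_fin invr_gt0.
apply: contra_notP nf2 => int_ny; apply/integrableP; split.
  by apply/measurable_EFinP/measurable_funM; exact: L1_measurable.
under eq_integral do rewrite /= ger0_norm -?expr2 ?sqr_ge0// expr2.
by rewrite ltey; exact/eqP.
Qed.

Lemma ecov_ge0 f : L1 f -> 0 <= ecov f f.
Proof.
move=> f1; have [f2|nf2] := pselect (L1 (fun t => f t * f t)%R).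
  by rewrite ecovE// lee_fin rcov_ge0.
by rewrite ecov_pinfty.
Qed.

Lemma ae_eq_rmean g : L1 g -> ecov g g = 0 ->
  ae_eq mu D (EFin \o g) (cst (rmean g)%:E).
Proof.
move=> g1 cg0; have [g2|ng2] := pselect (L1 (fun t => g t * g t)%R); last first.
  by move: cg0; rewrite ecov_pinfty.
have mg := L1_measurable _ g1.
set k := rmean g.
have msq : measurable_fun D (fun t => ((g t - k) ^+ 2)%:E).
  by apply/measurable_EFinP/measurable_funX/measurable_funB.
have sq1 : L1 (fun t => (g t - k) ^+ 2)%R.
  rewrite centered_sqrE.
  by apply: L1D => //; apply: L1D; [exact: L1Z|exact: L1_cst].
have int0 : \int[mu]_(t in D) `|((g t - k) ^+ 2)%:E| = 0.
  under eq_integral do rewrite gee0_abs ?lee_fin ?sqr_ge0//.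
  move: cg0; rewrite ecovE// rcov_centered// => -[/eqP].
  rewrite /rmean mulf_eq0 invr_eq0 gt_eqF//= => /eqP fine0.
  by rewrite -[LHS]fineK ?fine0// integrable_fin_num.
move/(ae_eq_integral_abs mu mD msq) : int0; apply: filterS => t /= gk Dt.
move: (gk Dt) => -[/eqP]; rewrite sqrf_eq0 subr_eq0 => /eqP gtk.
by rewrite gtk.
Qed.

(** This settles the indeterminate product 0 * +oo: f need not be square
    integrable, because f g agrees almost everywhere with a multiple of f. *)
Lemma ecov_degenerate f g : L1 f -> L1 g -> ecov g g = 0 -> ecov f g = 0.
Proof.
move=> f1 g1 cg0; rewrite /ecov (emeanE g)//.
have -> : emean (fun t => f t * g t)%R = emean (fun t => rmean g * f t)%R.
  rewrite /emean; congr (_ * _); apply: ae_eq_integral => //.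
  - by apply/measurable_EFinP/measurable_funM; exact: L1_measurable.
  - by apply: measurable_int (L1Z (rmean g) _ f1).
  apply: filterS (ae_eq_rmean _ g1 cg0) => t /= gk Dt.
  by case: (gk Dt) => ->; rewrite mulrC.
rewrite !emeanE//; last exact: L1Z.
by rewrite rmeanZ// -EFinM -EFinB mulrC subrr.
Qed.

(** The zero variances are disposed of first: after that, an infinite variance
    makes the right-hand side infinite. *)
Lemma ecov_cauchy_schwarz f g : L1 f -> L1 g ->
  `|ecov f g| <= ecov f f `^ 2^-1 * ecov g g `^ 2^-1.
Proof.
move=> f1 g1.
have half0 : (2^-1 != 0 :> R)%R by rewrite invr_eq0.
have := ecov_ge0 _ f1; rewrite le_eqVlt => /predU1P[cf0|cf_gt0].
  by rewrite -cf0 ecovC ecov_degenerate// abse0 poweR0r// mul0e.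
have := ecov_ge0 _ g1; rewrite le_eqVlt => /predU1P[cg0|cg_gt0].
  by rewrite -cg0 ecov_degenerate// abse0 poweR0r// mule0.
have [f2|nf2] := pselect (L1 (fun t => f t * f t)%R); last first.
  by rewrite (ecov_pinfty f)// poweRyr// gt0_mulye ?leey// poweR_gt0.
have [g2|ng2] := pselect (L1 (fun t => g t * g t)%R); last first.
  by rewrite (ecov_pinfty g)// poweRyr// gt0_muley ?leey// poweR_gt0.
have fg1 := L1M _ _ f1 g1 f2 g2.
rewrite !ecovE// !poweR_EFin -EFinM lee_fin -powRM ?rcov_ge0//.
rewrite powR12_sqrt ?mulr_ge0 ?rcov_ge0// -sqrtr_sqr.
by rewrite ler_sqrt ?rcov_cauchy_schwarz// mulr_ge0 ?rcov_ge0.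
Qed.

End covariance_on_a_set.

(** * The functional on an interval *)

Section cebysev_on_an_interval.
Context (R : realType).
Local Notation mu := (@completed_lebesgue_measure R).
Implicit Types (a b : R) (f g : R -> R).

Let measurable_itv_completed (i : interval R) :
  measurable ([set` i] : set (caratheodory_type (@wlength R idfun)^*%mu)).
Proof. by apply: sub_caratheodory; exact: measurable_itv. Qed.

(* The completed measure and the Lebesgue measure are restrictions of the same
   outer measure, hence convertible on intervals. *)
Let completed_measure_cc a b : (a < b)%R -> mu `[a, b] = (b - a)%:E.
Proof.
move=> ab; have := lebesgue_measure_itv `[a, b].
by rewrite /= lte_fin ab.
Qed.

Lemma integrable_onS a b alpha beta f : (a <= alpha)%R -> (beta <= b)%R ->
  integrable_on a b f -> integrable_on alpha beta f.
Proof.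
move=> aalpha betab; apply: integrableS => //.
by apply: subset_itv; rewrite bnd_simp.
Qed.

Lemma cebysev_ge0 a b f : (a < b)%R -> integrable_on a b f ->
  0 <= cebysev a b f f.
Proof.
move=> ab f1; apply: (ecov_ge0 _ _ _ mu `[a, b] (b - a)) => //.
  by rewrite subr_gt0.
exact: completed_measure_cc.
Qed.

Lemma cebysev_cauchy_schwarz a b f g : (a < b)%R ->
  integrable_on a b f -> integrable_on a b g ->
  `|cebysev a b f g| <= cebysev a b f f `^ 2^-1 * cebysev a b g g `^ 2^-1.
Proof.
move=> ab f1 g1; apply: (ecov_cauchy_schwarz _ _ _ mu `[a, b] (b - a)) => //.
  by rewrite subr_gt0.
exact: completed_measure_cc.
Qed.

Lemma integrable_on_step a b u : (a < b)%R ->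
  integrable_on a b (\1_(`]-oo, u[%classic) : R -> R).
Proof.
move=> ab; apply: measurable_bounded_integrable => //.
- by rewrite [ltLHS](completed_measure_cc _ _ ab) ltry.
- exists 1%R; split => // M M1 t _ /=.
  by rewrite indicE normr_nat (le_trans _ (ltW M1))// lern1 leq_b1.
Qed.

(** The step function is idempotent, so its variance is p - p ^ 2 where
    p = (u - a) / (b - a) is its mean. *)
Lemma cebysev_step a b u : (a <= u <= b)%R -> (a < b)%R ->
  let f := \1_(`]-oo, u[%classic) : R -> R in
  cebysev a b f f = ((u - a) * (b - u) / (b - a) ^+ 2)%:E.
Proof.
move=> /andP[au ub] ab /=; set f := (X in cebysev _ _ X _).
have -> : cebysev a b f f = mean a b f - mean a b f * mean a b f.
  rewrite /cebysev; congr (mean _ _ _ - _); apply/funext => t.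
  by rewrite /f indicE; case: (_ \in _); rewrite ?mulr1 ?mulr0.
have -> : mean a b f = ((u - a) / (b - a))%:E.
  rewrite /mean integral_indic//.
  have -> : (`]-oo, u[ `&` `[a, b] = `[a, u[ :> set R)%classic.
    apply/seteqP; split => t /=; rewrite !in_itv /=.
      by move=> [tu /andP[-> _]]; rewrite tu.
    by move=> /andP[-> tu]; rewrite tu (le_trans (ltW tu) ub).
  rewrite [X in _ * X](_ : _ = (u - a)%:E); first by rewrite -EFinM mulrC.
  apply: (etrans (lebesgue_measure_itv `[a, u[)); rewrite /= lte_fin.
  by case: ltP => // ua; congr EFin; lra.
rewrite -EFinM -EFinB; congr EFin; field.
by rewrite subr_eq0 gt_eqF.
Qed.

End cebysev_on_an_interval.

(** * Sharpness *)

(** The variance of the step at u is maximal, equal to 1/4, on [a, b] when u is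
    the midpoint, and zero on [u, b]; the second interval thus contributes
    nothing, and f = g makes Cauchy-Schwarz and AM-GM equalities on the first. *)
Lemma step_attains_bounds (R : realType) (a b : R) : (a < b)%R ->
  exists f : R -> R, exists u : R,
  [/\ integrable_on a b f, (a <= u)%R, (u < b)%R &
   [/\ `| cebysev a b f f - cebysev u b f f | = (4^-1)%:E,
       product_bound a b u b f f = (4^-1)%:E &
       sum_bound a b u b f f = (4^-1)%:E]].
Proof.
move=> ab; set u := ((a + b) / 2)%R.
have ub : (u < b)%R by rewrite /u; lra.
have au : (a <= u)%R by rewrite /u; lra.
exists (\1_(`]-oo, u[%classic)), u; split => //.
  exact: integrable_on_step.
have ba : (b - a != 0)%R by rewrite subr_eq0 gt_eqF.
have := cebysev_step _ a b u; rewrite au ltW// => /(_ isT ab) /=.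
have := cebysev_step _ u b u; rewrite lexx ltW// => /(_ isT ub) /=.
set f := \1__; rewrite subrr !mul0r => cu.
have -> : ((u - a) * (b - u) / (b - a) ^+ 2)%R = (4^-1 : R)%R.
  by rewrite /u; field.
move=> ca; rewrite /product_bound /sum_bound ca cu.
split.
- by rewrite sube0 gee0_abs// lee_fin invr_ge0.
- rewrite !poweR_EFin -!EFinM -EFinD powR0 ?invr_eq0// mul0r addr0.
  by rewrite powR12_sqrt ?invr_ge0// -expr2 sqr_sqrtr ?invr_ge0.
- by rewrite !adde0 -EFinD -EFinM; congr EFin; field.
Qed.

Lemma quarter_not_le_scaled (R : realType) (c : R) : (c < 1)%R ->
  ~ ((4^-1)%:E <= c%:E * (4^-1)%:E).
Proof. by rewrite -EFinM lee_fin => c1; lra. Qed.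

(** * The double inequality and its sharpness *)

Theorem theorem3 (R : realType) (a b : R) (hab : (a < b)%R) :
  (forall f g : R -> R, integrable_on a b f -> integrable_on a b g ->
   forall u v : R, (a <= u)%R -> (u < v)%R -> (v <= b)%R ->
     `| cebysev a v f g - cebysev u b f g | <= product_bound a b u v f g
     /\
     product_bound a b u v f g <= sum_bound a b u v f g)
  /\
  (forall c : R, (c < 1)%R ->
     ~ (forall f g : R -> R, integrable_on a b f -> integrable_on a b g ->
        forall u v : R, (a <= u)%R -> (u < v)%R -> (v <= b)%R ->
          `| cebysev a v f g - cebysev u b f g |
            <= c%:E * product_bound a b u v f g)
     /\
     ~ (forall f g : R -> R, integrable_on a b f -> integrable_on a b g ->
        forall u v : R, (a <= u)%R -> (u < v)%R -> (v <= b)%R ->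
          product_bound a b u v f g <= c%:E * sum_bound a b u v f g)
     /\
     ~ (forall f g : R -> R, integrable_on a b f -> integrable_on a b g ->
        forall u v : R, (a <= u)%R -> (u < v)%R -> (v <= b)%R ->
          `| cebysev a v f g - cebysev u b f g |
            <= c%:E * sum_bound a b u v f g)).
Proof.
split=> [f g f1 g1 u v au uv vb|c c1].
  have av := le_lt_trans au uv; have ub := lt_le_trans uv vb.
  have fav := integrable_onS _ _ _ _ _ _ (lexx a) vb f1.
  have gav := integrable_onS _ _ _ _ _ _ (lexx a) vb g1.
  have fub := integrable_onS _ _ _ _ _ _ au (lexx b) f1.
  have gub := integrable_onS _ _ _ _ _ _ au (lexx b) g1.
  split.
    apply: (le_trans (lee_abs_sub _ _)).
    by apply: leeD; exact: cebysev_cauchy_schwarz.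
  have ff_av := cebysev_ge0 _ _ _ _ av fav; have gg_av := cebysev_ge0 _ _ _ _ av gav.
  have ff_ub := cebysev_ge0 _ _ _ _ ub fub; have gg_ub := cebysev_ge0 _ _ _ _ ub gub.
  rewrite /sum_bound -addeA ge0_muleDr; [|exact: adde_ge0..].
  by apply: leeD; exact: poweR_am_gm.
have [f [u [f1 au ub [lhs prod sum]]]] := step_attains_bounds _ _ _ hab.
have nle := quarter_not_le_scaled _ _ c1.
split; [|split] => /(_ f f f1 f1 u b au ub (lexx b)).
- by rewrite lhs prod.
- by rewrite prod sum.
- by rewrite lhs sum.
Qed.
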